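(* Every nonempty prefix $w$ of the Thue-Morse word $\mathbf{t}$ has circular critical exponent $$\mathrm{cce}(w) \in \left\{ 1, 2, \tfrac{7}{3}, \tfrac{5}{2}, \tfrac{13}{5}, \tfrac{8}{3}, 3 \right\}.$$
   Context: The Thue-Morse word $\mathbf{t} = t_0 t_1 t_2 \cdots = 01101001\cdots$ is the infinite fixed point, starting with $0$, of the morphism $\mu$ with $\mu(0)=01$, $\mu(1)=10$. A nonempty finite word $w$ (indexed from $0$) has period $p$, where $1 \le p \le |w|$, if $w[i]=w[i+p]$ for all $i$ with $0 \le i < |w|-p$. The smallest period of $w$ is denoted $p(w)$, and the exponent of $w$ is $\exp(w) = |w|/p(w)$. A factor of a word is a contiguous block inside it. The conjugates of a finite word $w$ are its cyclic shifts, i.e. the words $yx$ with $w = xy$ ($x,y$ possibly empty). The circular critical exponent $\mathrm{cce}(w)$ of a nonempty finite word $w$ is the supremum (maximum) of $\exp(x)$ over all nonempty factors $x$ of all conjugates of $w$. *)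

(* Defs.v *)
From mathcomp Require Import all_boot all_order all_algebra.
Set Implicit Arguments.
Unset Strict Implicit.
Unset Printing Implicit Defensive.
Import Order.TTheory GRing.Theory Num.Theory.
Local Open Scope nat_scope.

(* Words over {0, 1}, with 0 encoded as [false] and 1 as [true]. *)
Notation word := (seq bool).

(* The letter morphism 0 |-> 01, 1 |-> 10 extended to finite words. *)
Definition mu (w : word) : word := flatten [seq [:: a; ~~ a] | a <- w].

(* The limit of 0, mu 0, mu (mu 0), ...: each iterate is a prefix of the next
   and the i-th one has length 2 ^ i > i, so it already shows the letter of
   index i. See [thue_morse_fixed] and [thue_morse_unique]. *)
Definition thue_morse (i : nat) : bool := nth false (iter i mu [:: false]) i.

Definition tm_prefix (n : nat) : word := mkseq thue_morse n.

Definition has_period (w : word) (p : nat) : bool :=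
  [&& 1 <= p, p <= size w &
      [forall i : 'I_(size w - p), nth false w i == nth false w (i + p)]].

(* The default candidate [ord_max] is [size w], a period of any nonempty w. *)
Definition period (w : word) : nat :=
  [arg min_(p < @ord_max (size w) | has_period w p) (p : nat)].

Definition exponent (w : word) : rat := ((size w)%:R / (period w)%:R)%R.

(* [rot i w = drop i w ++ take i w]. *)
Definition conjugates (w : word) : seq word :=
  [seq rot i w | i <- iota 0 (size w).+1].

(* [take l (drop i w)], over all starts i and lengths l (with repetitions). *)
Definition factors (w : word) : seq word :=
  [seq take l (drop i w) | i <- iota 0 (size w).+1, l <- iota 0 (size w).+1].

Definition circular_factors (w : word) : seq word :=
  [seq x <- flatten [seq factors v | v <- conjugates w] | x != [::]].

(* The bottom value 0 is harmless: exponents of nonempty words are positive,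
   so for nonempty w this is a genuine maximum; see [cce_attained]. *)
Definition cce (w : word) : rat :=
  \big[Order.max/0%R]_(x <- circular_factors w) exponent x.

Lemma size_mu w : size (mu w) = (size w).*2.
Proof. by elim: w => //= a w IH; rewrite -/(mu w) IH doubleS. Qed.

Lemma mu_cat u v : mu (u ++ v) = mu u ++ mu v.
Proof. by rewrite /mu map_cat flatten_cat. Qed.

Lemma nth_mu w i : i < (size w).*2 ->
  nth false (mu w) i = odd i (+) nth false w i./2.
Proof.
elim: w i => [|a w IH] [|[|i]] //= lti.
- by rewrite negbK -IH.
Qed.

Lemma size_iter_mu k : size (iter k mu [:: false]) = 2 ^ k.
Proof. by elim: k => //= k IH; rewrite size_mu IH expnS mul2n. Qed.

Lemma iter_mu_step k : exists v,
  iter k.+1 mu [:: false] = iter k mu [:: false] ++ v.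
Proof.
elim: k => [|k [v IH]]; first by exists [:: true].
by exists (mu v); exact: etrans (congr1 mu IH) (mu_cat _ _).
Qed.

Lemma thue_morse_iter k i : i < 2 ^ k ->
  nth false (iter k mu [:: false]) i = thue_morse i.
Proof.
have mono m d j : j < 2 ^ m ->
    nth false (iter (d + m) mu [:: false]) j = nth false (iter m mu [:: false]) j.
  move=> ltj; elim: d => // d <-; rewrite addSn.
  have [v ->] := iter_mu_step (d + m).
  rewrite nth_cat size_iter_mu (leq_trans ltj) //.
  by rewrite leq_exp2l // leq_addl.
move=> lti; rewrite /thue_morse; case: (leqP i k) => [leik|/ltnW leki].
  by rewrite -(mono i (k - i) i) ?subnK // ltn_expl.
by rewrite -(mono k (i - k) i lti) subnK.
Qed.

Lemma thue_morse0 : thue_morse 0 = false.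
Proof. by []. Qed.

Lemma thue_morse_fixed n : mu (tm_prefix n) = tm_prefix n.*2.
Proof.
apply: (@eq_from_nth _ false); rewrite size_mu !size_mkseq // => i lti.
rewrite nth_mu ?size_mkseq // !nth_mkseq //; last by rewrite ltn_half_double.
have lti2 : i < 2 ^ i.+1 by apply: ltn_trans (ltn_expl _ (ltnSn 1)) _; rewrite ltn_exp2l.
rewrite -(thue_morse_iter lti2) iterS nth_mu; last first.
  by rewrite size_iter_mu -mul2n -expnS.
by rewrite thue_morse_iter // ltn_half_double -mul2n -expnS.
Qed.

Lemma thue_morse_unique (t : nat -> bool) :
  t 0 = false -> (forall n, mu (mkseq t n) = mkseq t n.*2) -> t =1 thue_morse.
Proof.
move=> t0 tfix i; rewrite /thue_morse.
have it k : iter k mu [:: false] = mkseq t (2 ^ k).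
  elim: k => [|k IH]; first by rewrite /mkseq /= t0.
  by rewrite iterS IH tfix expnS mul2n.
by rewrite it nth_mkseq // ltn_expl.
Qed.

Lemma period_spec w : w != [::] ->
  has_period w (period w) /\ (forall p, has_period w p -> period w <= p).
Proof.
rewrite -size_eq0 -lt0n => w0; rewrite /period; case: arg_minnP => [|p hp minp].
  rewrite /has_period /= w0 leqnn subnn; apply/forallP => -[] //.
split=> // q hq; have [_ leq _] := and3P hq.
by have := minp (Ordinal (leq : q < (size w).+1)) hq.
Qed.

Lemma conjugatesP w v :
  reflect (exists x y, w = x ++ y /\ v = y ++ x) (v \in conjugates w).
Proof.
apply: (iffP mapP) => [[i _ ->]|[x [y [-> ->]]]].
  by exists (take i w), (drop i w); rewrite cat_take_drop.
exists (size x); last by rewrite rot_size_cat.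
by rewrite mem_iota /= add0n ltnS size_cat leq_addr.
Qed.

Lemma factorsP w x : reflect (exists u v, w = u ++ x ++ v) (x \in factors w).
Proof.
apply: (iffP allpairsP) => [[[i l] /= [_ _ ->]]|[u [v ->]]].
  by exists (take i w), (drop l (drop i w)); rewrite !cat_take_drop.
exists (size u, size x); split.
- by rewrite mem_iota add0n ltnS size_cat /= leq_addr.
- by rewrite mem_iota add0n ltnS !size_cat addnCA /= leq_addr.
by rewrite drop_size_cat // take_size_cat.
Qed.

Lemma circular_factorsP w x :
  reflect (x <> [::] /\ exists2 v, v \in conjugates w & x \in factors v)
          (x \in circular_factors w).
Proof.
rewrite mem_filter; apply: (iffP andP) => [[/eqP x0 /flatten_mapP]|[/eqP x0 h]].
  by split.
by split=> //; apply/flatten_mapP.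
Qed.

Lemma cce_ub w x : x \in circular_factors w -> (exponent x <= cce w)%R.
Proof. by move=> xw; apply: le_bigmax_seq. Qed.

Lemma cce_attained w : w <> [::] ->
  exists2 x, x \in circular_factors w & cce w = exponent x.
Proof.
move=> w0; have ww : w \in circular_factors w.
  apply/circular_factorsP; split=> //; exists w.
    by apply/conjugatesP; exists [::], w; rewrite cats0.
  by apply/factorsP; exists [::], [::]; rewrite cats0.
have: (cce w == 0)%R || has (fun x => cce w == exponent x) (circular_factors w).
  rewrite /cce; elim: (circular_factors w) => [|x s IH]; first by rewrite big_nil eqxx.
  rewrite big_cons /=; case: (leP (exponent x)) => _; last by rewrite eqxx orbT.
  by case/orP: IH => ->; rewrite ?orbT.
case/orP => [/eqP c0|/hasP[x xs /eqP]]; last by exists x.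
exists w => //; apply/eqP; rewrite eq_le cce_ub // andbT c0.
by rewrite divr_ge0 // ler0n.
Qed.

(* Main.v *)
Require Import Defs.
From mathcomp Require Import all_boot all_order all_algebra zify.
Import Order.TTheory GRing.Theory Num.Theory.

(* For n = 2m the circular word is the mu-image of the one for m. There a run
   (a repetition of period p) of exponent > 2 has even period, and it extends
   to the mu-image of a run of half the period, so an exponent above 2 is
   inherited from m.
   For n odd, the pairing of letters into blocks 01, 10 changes parity at the
   seam where the end of the prefix meets its start. Comparing the blocks of
   both copies of a period yields alternating factors of t, which have length
   at most 4. Hence a run of exponent > 7/3 has period at most 23 and extends at
   most 27 letters to each side of the seam. Once n is large, the letters within
   distance 27 of the seam thus determine the exponent as soon as they contain
   one that is >= 7/3; there are few possible windows, and all are checked by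
   computation, as are all n <= 55. *)

Local Open Scope nat_scope.

(** * Runs in periodic sequences and the critical exponent *)

(** The period [p] need not be least. Working on infinite sequences lets one notion serve both the
    Thue-Morse word and circular words. *)
Definition run (c : nat -> bool) (i l p : nat) : Prop :=
  [/\ 0 < p, p <= l & forall j, i <= j -> j + p < i + l -> c j = c (j + p)].

Definition cyc (w : word) (k : nat) : bool := nth false w (k %% size w).

Lemma run_cyc_modn w i l p : run (cyc w) i l p <-> run (cyc w) (i %% size w) l p.
Proof.
have shift j a : cyc w (a * size w + j) = cyc w j by rewrite /cyc modnMDl.
have e := divn_eq i (size w).
split=> -[p0 pl h]; split=> // j ij jl.
  rewrite -(shift j (i %/ size w)) -(shift (j + p) (i %/ size w)) addnA.
  by apply: h; lia.
have -> : j = i %/ size w * size w + (j - i %/ size w * size w) by lia.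
by rewrite -addnA !shift; apply: h; lia.
Qed.

Lemma nth_cat_cyc (a b : word) k : k < size (a ++ b) ->
  nth false (b ++ a) k = cyc (a ++ b) (size a + k).
Proof.
rewrite /cyc size_cat nth_cat => kn; case: ltnP => kb.
  by rewrite modn_small ?ltn_add2l // nth_cat ltnNge leq_addr addKn.
have -> : size a + k = (size a + size b) + (k - size b) by lia.
by rewrite modnDl modn_small ?nth_cat; [case: ltnP => //; lia | lia].
Qed.

Lemma has_periodP (c : nat -> bool) (x : word) i p :
  (forall j, j < size x -> nth false x j = c (i + j)) ->
  reflect (run c i (size x) p) (has_period x p).
Proof.
move=> xc; apply: (iffP and3P) => [[p0 px /forallP h]|[p0 px h]]; split=> //.
  move=> j ij jl; have jp : j - i < size x - p by lia.
  have /eqP := h (Ordinal jp); rewrite /= !xc; [|lia..].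
  by rewrite addnA subnKC.
apply/forallP => -[j jp] /=; rewrite !xc; [|lia..].
by apply/eqP; rewrite addnA; apply: h; lia.
Qed.

(** The run is a prefix of a conjugate of [w]; its least period is at most [p], so its exponent is
    at least [l / p]. *)
Lemma cce_ge_run w i l p : l <= size w -> run (cyc w) i l p ->
  (l%:R / p%:R <= cce w)%R.
Proof.
move=> lw; rewrite run_cyc_modn => hr; have [p0 pl _] := hr.
have iw : i %% size w < size w by rewrite ltn_mod; lia.
move: {i} (i %% size w) iw hr => i iw hr.
pose x := take l (rot i w).
have sx : size x = l by rewrite size_takel ?size_rot.
have x0 : x <> [::] by move=> x0; move: sx; rewrite x0 /=; lia.
have xc : x \in circular_factors w.
  apply/circular_factorsP; split=> //; exists (rot i w).
    by apply/conjugatesP; exists (take i w), (drop i w); rewrite cat_take_drop.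
  by apply/factorsP; exists [::], (drop l (rot i w)); rewrite cat_take_drop.
apply: le_trans (cce_ub xc).
have xn j : j < size x -> nth false x j = cyc w (i + j).
  rewrite sx => jl; rewrite nth_take // nth_cat_cyc cat_take_drop; last lia.
  by rewrite size_takel // ltnW.
have hp : has_period x p by apply/(has_periodP _ _ _ _ xn); rewrite sx.
have [|/and3P[q0 _ _] qp] := @period_spec x; first exact/eqP.
rewrite /exponent sx ler_wpM2l ?ler0n // lef_pV2 ?posrE ?ltr0n //.
by rewrite ler_nat qp.
Qed.

Lemma cce_eq_run w : w <> [::] -> exists i l p,
  [/\ i < size w, l <= size w, run (cyc w) i l p & cce w = (l%:R / p%:R)%R].
Proof.
move=> w0; have [x xw cx] : exists2 x : word, x \in circular_factors w &
    cce w = exponent x by exact: cce_attained.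
have [x0 [v /conjugatesP[a [b [wab ->]]]]] := circular_factorsP _ _ xw.
rewrite {xw}cx {w w0}wab => /factorsP[u [v' e]].
have se : size (a ++ b) = size u + size x + size v'.
  by have := congr1 size e; rewrite !size_cat; lia.
have [|hp _] := @period_spec x; first exact/eqP.
exists ((size a + size u) %% size (a ++ b)), (size x), (period x); split=> //.
- have x1 : 0 < size x by rewrite lt0n size_eq0; exact/eqP.
  by rewrite ltn_mod se; lia.
- by rewrite se; lia.
apply: (proj1 (run_cyc_modn _ _ _ _)); apply: (elimT (has_periodP _ _ _ _ _)) hp => j jx.
rewrite -addnA -nth_cat_cyc; last by rewrite se; lia.
by rewrite e nth_cat ltnNge leq_addr addKn nth_cat jx.
Qed.

(** * Runs and the morphism [mu] *)

(* An odd shift sends block boundaries to block interiors, so the word alternates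
   on a whole period, contradicting that the period is odd. *)
Lemma run_le_odd_period c i l p :
  (forall k, c k.*2.+1 = ~~ c k.*2) -> run c i l p -> odd p -> l <= p.*2.
Proof.
move=> cB [p0 _ h] op; apply/negP => /negP; rewrite -ltnNge => lp.
have dif j : ~~ odd j -> c j.+1 = ~~ c j.
  by move=> oj; have -> : j = j./2.*2 by [lia]; apply: cB.
have alt j : i <= j -> j < i + p -> c j.+1 = ~~ c j.
  move=> ij jp; have [oj|/dif//] := boolP (odd j).
  rewrite (h j) ?(h j.+1) ?addSn; try lia.
  by apply: dif; rewrite oddD oj op.
have run_alt k : k <= p -> c (i + k) = c i (+) odd k.
  elim: k => [|k IH] kp; first by rewrite addn0 addbF.
  by rewrite addnS alt ?IH ?addbN //; lia.
have := run_alt p (leqnn _); rewrite -h ?op; [|lia..].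
by case: (c i).
Qed.

(* The run is first widened to whole blocks, hence the rounding of both ends. *)
Lemma run_half c d i l q :
  (forall k, c k.*2 = d k) -> (forall k, c k.*2.+1 = ~~ d k) ->
  run c i l q.*2 -> q.*2 < l -> run d i./2 (uphalf (i + l) - i./2) q.
Proof.
move=> c0 c1 [q0 _ h] ql; split; try lia.
move=> k ik kq.
have [ik2|ki2] := leqP i k.*2.
  by have := h k.*2 ik2; rewrite -doubleD !c0; apply; lia.
have := h k.*2.+1; rewrite addSn -doubleD !c1 => e.
by apply: negb_inj; apply: e; lia.
Qed.

Lemma run_double c d i l q :
  (forall k, c k.*2 = d k) -> (forall k, c k.*2.+1 = ~~ d k) ->
  run d i l q -> run c i.*2 l.*2 q.*2.
Proof.
move=> c0 c1 [q0 ql h]; split; try lia.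
move=> j ij jq; have e := h j./2; have [oj|oj] := boolP (odd j).
  have -> : j = j./2.*2.+1 by lia.
  by rewrite addSn -doubleD !c1 e //; lia.
have -> : j = j./2.*2 by lia.
by rewrite -doubleD !c0 e //; lia.
Qed.

(** * Overlap-freeness and block structure of the Thue-Morse word *)

Lemma thue_morse_double k : thue_morse k.*2 = thue_morse k.
Proof.
have /(congr1 (fun w => nth false w k.*2)) := thue_morse_fixed k.+1.
rewrite nth_mu ?size_mkseq ?nth_mkseq; [|lia..].
by rewrite odd_double doubleK => <-.
Qed.

Lemma thue_morse_doubleS k : thue_morse k.*2.+1 = ~~ thue_morse k.
Proof.
have /(congr1 (fun w => nth false w k.*2.+1)) := thue_morse_fixed k.+1.
rewrite nth_mu ?size_mkseq ?nth_mkseq; [|lia..].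
by rewrite /= odd_double uphalf_double => <-.
Qed.

(** Descent on the period: an overlap cannot have odd period, and one of even period yields an
    overlap of half the period. *)
Lemma thue_morse_overlap_free i l p : run thue_morse i l p -> l <= p.*2.
Proof.
elim/ltn_ind: p i l => p IH i l hr; have [op|ep] := boolP (odd p).
  apply: run_le_odd_period hr op => k.
  by rewrite thue_morse_double thue_morse_doubleS.
rewrite leqNgt; apply/negP => pl; have [p0 _ _] := hr.
have e : p = p./2.*2 by lia.
rewrite e in hr; have := run_half _ _ _ _ _ thue_morse_double thue_morse_doubleS hr.
have q : p./2 < p by lia.
by move=> H; have := IH _ q _ _ (H _); lia.
Qed.

(** An alternating factor of length at least 2 is a run of period 2. *)
Lemma thue_morse_alternating i l :
  (forall j, i <= j -> j.+1 < i + l -> thue_morse j.+1 = ~~ thue_morse j) ->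
  l <= 4.
Proof.
move=> h; case: l h => [|l] // h; case: l h => [|l] // h.
apply: (thue_morse_overlap_free i _ 2); split=> // j ij jl.
by rewrite addn2 !h ?negbK //; lia.
Qed.

Lemma run_sub c d i a b l l' p : run c i l p -> p <= l' ->
  i <= a -> a + l' <= i + l -> (forall k, k < l' -> c (a + k) = d (b + k)) ->
  run d b l' p.
Proof.
move=> [p0 _ h] pl ia al cd; split=> // j bj jl.
have -> : j = b + (j - b) by lia.
by rewrite -addnA -!cd; [rewrite addnA; apply: h; lia | lia..].
Qed.

Lemma thue_morse_evenS k : ~~ odd k -> thue_morse k.+1 = ~~ thue_morse k.
Proof.
move=> ek; have -> : k = k./2.*2 by lia.
by rewrite thue_morse_double thue_morse_doubleS.
Qed.

(** The block of length [2 ^ k] with index [a] is the [k]-th iterate of [mu] on the letter of index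
    [a]: a prefix of the word, complemented if that letter is 1. *)
Lemma thue_morse_block k a b : b < 2 ^ k ->
  thue_morse (a * 2 ^ k + b) = thue_morse a (+) thue_morse b.
Proof.
elim: k a b => [|k IH] a b.
  by rewrite expn0 ltnS leqn0 muln1 => /eqP->; rewrite addn0 addbF.
rewrite expnS => bk; have bk2 : b./2 < 2 ^ k by lia.
have [ob|eb] := boolP (odd b).
  have -> : a * (2 * 2 ^ k) + b = (a * 2 ^ k + b./2).*2.+1 by lia.
  have -> : thue_morse b = thue_morse b./2.*2.+1 by congr thue_morse; lia.
  by rewrite !thue_morse_doubleS IH // addbN.
have -> : a * (2 * 2 ^ k) + b = (a * 2 ^ k + b./2).*2 by lia.
have -> : thue_morse b = thue_morse b./2.*2 by congr thue_morse; lia.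
by rewrite !thue_morse_double IH.
Qed.

(** * Prefixes as circular words: runs near the seam for odd length *)

Lemma size_tm_prefix n : size (tm_prefix n) = n.
Proof. exact: size_mkseq. Qed.

Lemma tm_prefix_take k n : n <= 2 ^ k ->
  tm_prefix n = take n (iter k mu [:: false]).
Proof.
move=> nk; apply: (@eq_from_nth _ false).
  by rewrite size_tm_prefix size_takel // size_iter_mu.
move=> i; rewrite size_tm_prefix => lin.
by rewrite nth_mkseq // nth_take // thue_morse_iter //; apply: leq_trans nk.
Qed.

Lemma cyc_tm_prefix n k : 0 < n ->
  cyc (tm_prefix n) k = thue_morse (k %% n).
Proof. by move=> n0; rewrite /cyc size_tm_prefix nth_mkseq // ltn_mod. Qed.

Lemma cyc_tm_prefix_l n k : k < n -> cyc (tm_prefix n) k = thue_morse k.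
Proof. by move=> kn; rewrite cyc_tm_prefix ?modn_small //; lia. Qed.

Lemma cyc_tm_prefix_r n k : k < n -> cyc (tm_prefix n) (n + k) = thue_morse k.
Proof. by move=> kn; rewrite cyc_tm_prefix ?modnDl ?modn_small //; lia. Qed.

Lemma odd_tm_prefix_run n i l p : odd n -> i < n -> l <= n ->
  run (cyc (tm_prefix n)) i l p -> 7 * p < 3 * l ->
  [/\ p <= 23, n <= i + 27 & i + l <= n + 27].
Proof.
move=> on lin ln hr lp; have [p0 pl h] := hr.
set c := cyc _ in hr h.
have cl k : k < n -> c k = thue_morse k by exact: cyc_tm_prefix_l.
have cr k : k < n -> c (n + k) = thue_morse k by exact: cyc_tm_prefix_r.
have cross : n < i + l.
  rewrite ltnNge; apply/negP => il.
  suff: l <= p.*2 by lia.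
  apply: (thue_morse_overlap_free i); apply: (run_sub _ _ i i i _ _ _ hr); try lia.
  by move=> k kl; apply: cl; lia.
(* The parts of the run before and after the seam are each factors of the Thue-Morse word. *)
have s2 : n - i <= p.*2.
  have [|ps] := leqP (n - i) p; first lia.
  apply: (thue_morse_overlap_free i).
  apply: (run_sub _ _ i i i _ _ _ hr); try lia.
  by move=> k kl; apply: cl; lia.
have r2 : i + l - n <= p.*2.
  have [|pr] := leqP (i + l - n) p; first lia.
  apply: (thue_morse_overlap_free 0).
  apply: (run_sub _ _ i n 0 _ _ _ hr); try lia.
  by move=> k kl; rewrite add0n cr //; lia.
(* For odd [p], one of [j] and [j + p] starts a block, so the repeated part on each side alternates.
   Each side then has at most [p + 4] letters, so [l <= 2p + 8]; with [7p < 3l] this gives [p <= 23]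
   and sides of at most 27. *)
have [op|ep] := boolP (odd p).
  have s4 : n - p - i <= 4.
    apply: (thue_morse_alternating i) => j ij jl.
    have [oj|] := boolP (odd j); last exact: thue_morse_evenS.
    rewrite -!cl ?(h j) ?(h j.+1) ?addSn ?cl; try lia.
    by apply: thue_morse_evenS; lia.
  have r4 : i + l - n - p <= 4.
    apply: (thue_morse_alternating 0) => j _ jl.
    have [oj|] := boolP (odd j); last exact: thue_morse_evenS.
    rewrite -!cr ?(h (n + j)) ?(h (n + j.+1)) -?addnA ?cr; try lia.
    by rewrite addSn; apply: thue_morse_evenS; lia.
  by split; lia.
(* For even [p], compare positions [j] before the seam with [j + p] after it: as [n] is odd, [j] and
   [j + p - n] have opposite parity, so this stretch alternates. *)
pose a := maxn i (n - p).
have d4 : minn n (i + l - p) - a <= 4.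
  apply: (thue_morse_alternating a) => j ij jl.
  have [oj|] := boolP (odd j); last exact: thue_morse_evenS.
  rewrite -!cl ?(h j) ?(h j.+1); try lia.
  have [k jk] : exists k, j + p = n + k by exists (j + p - n); lia.
  by rewrite addSn jk -addnS !cr; [apply: thue_morse_evenS; lia | lia..].
by split; lia.
Qed.

(** * Computing the longest runs of a finite word *)

Fixpoint longest_true (e : bitseq) : nat :=
  if e is _ :: e' then maxn (find negb e) (longest_true e') else 0.

Lemma longest_true_ge e k m : k + m <= size e ->
  (forall j, j < m -> nth false e (k + j)) -> m <= longest_true e.
Proof.
elim: e k => [|b e IH] [|k] km h; try by move: km => /=; lia.
  have : m <= find negb (b :: e); last by rewrite /= leq_max => ->.
  rewrite leqNgt; apply/negP => fm.
  have : has negb (b :: e) by rewrite has_find; lia.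
  by move/(nth_find false); rewrite h.
by rewrite leq_max (IH k) ?orbT.
Qed.

Lemma longest_true_attained e : exists2 k, k + longest_true e <= size e &
  forall j, j < longest_true e -> nth false e (k + j).
Proof.
elim: e => [|b e [k ke h]]; first by exists 0.
rewrite -[longest_true _]/(maxn (find negb (b :: e)) (longest_true e)).
case: leqP => _; first by exists k.+1.
exists 0 => [|j jf]; first exact: find_size.
by have /negbFE := before_find false jf.
Qed.

(** A block of [m] consecutive [true]s is a run of period [p] and length [p + m]. *)
Definition repeats (p : nat) (z : word) : bitseq :=
  [seq x.1 == x.2 | x <- zip z (drop p z)].

Lemma size_repeats p z : size (repeats p z) = size z - p.
Proof. by rewrite size_map size_zip size_drop; apply/minn_idPr/leq_subr. Qed.

Lemma nth_repeats p z j : j + p < size z ->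
  nth false (repeats p z) j = (nth false z j == nth false z (j + p)).
Proof.
have := size_repeats p z; rewrite size_map => sz jp.
rewrite (nth_map (false, false)) ?sz; last lia.
by rewrite nth_zip_cond sz ifT ?nth_drop 1?addnC //; lia.
Qed.

(* Runs are capped at length N because a circular factor is no longer than the
   word, whereas z may be. *)
Definition longest_run (N : nat) (z : word) (p : nat) : nat :=
  minn N (p + longest_true (repeats p z)).

Lemma longest_run_attained c a N z p :
  (forall j, j < size z -> c (a + j) = nth false z j) ->
  0 < p -> p <= N -> p <= size z -> exists i, run c i (longest_run N z p) p.
Proof.
move=> cz p0 pN pz; have [k] := longest_true_attained (repeats p z).
rewrite size_repeats => kz h; exists (a + k); rewrite /longest_run.
split=> // [|j kj jl]; first lia.
have -> : j = a + (j - a) by lia.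
have := h (j - a - k); rewrite subnKC ?nth_repeats; [|lia..].
by move=> e; rewrite -addnA !cz; [apply/eqP/e; lia | lia..].
Qed.

Lemma longest_run_ge c a N z k l p :
  (forall j, j < size z -> c (a + j) = nth false z j) ->
  run c (a + k) l p -> k + l <= size z -> l <= N -> l <= longest_run N z p.
Proof.
move=> cz [p0 pl h] kl lN; rewrite leq_min lN -leq_subLR.
apply: (longest_true_ge _ k) => [|j jl]; first by rewrite size_repeats; lia.
rewrite nth_repeats; last lia.
by rewrite -!cz; [apply/eqP; rewrite !addnA; apply: h; lia | lia..].
Qed.

(** The fraction [q.1 / q.2] is the largest ratio of length to period, cross-multiplied so that the
    test stays in [nat]. *)
Definition max_ratio (N : nat) (z : word) (P : nat) (q : nat * nat) : bool :=
  all (fun p => longest_run N z p * q.2 <= q.1 * p) (iota 1 P) &&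
  has (fun p => longest_run N z p * q.2 == q.1 * p) (iota 1 P).

Lemma ler_frac (a b c d : nat) : 0 < b -> 0 < d ->
  (a%:R / b%:R <= c%:R / d%:R :> rat)%R = (a * d <= c * b).
Proof.
move=> b0 d0; rewrite ler_pdivrMr ?ltr0n // mulrAC ler_pdivlMr ?ltr0n //.
by rewrite -!natrM ler_nat.
Qed.

(** The window [z] must capture only the runs of ratio above [q]: each would contradict the computed
    maximum, while the run attaining it bounds [cce] from below. *)
Lemma cce_max_ratio w a N z P q :
  w <> [::] -> 0 < q.2 -> N <= size w -> P <= N -> P <= size z ->
  (forall j, j < size z -> cyc w (a + j) = nth false z j) ->
  (forall i l p, i < size w -> l <= size w -> run (cyc w) i l p ->
     q.1 * p < l * q.2 ->
     exists k, [/\ p <= P, l <= N, k + l <= size z & run (cyc w) (a + k) l p]) ->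
  max_ratio N z P q -> cce w = (q.1%:R / q.2%:R)%R.
Proof.
move=> w0 q0 Nw PN Pz cz win /andP[/allP ub /hasP[p pP /eqP e]].
rewrite mem_iota in pP; apply/le_anti/andP; split.
  have [i [l [r [iw lw hr ->]]]] := cce_eq_run _ w0; have [r0 rl _] := hr.
  rewrite ler_frac // leqNgt; apply/negP => lt.
  have [k [rP lN kl hk]] := win _ _ _ iw lw hr lt.
  have := longest_run_ge _ _ N _ _ _ _ cz hk kl lN.
  have := ub r; rewrite mem_iota => /(_ _) h1 h2.
  have {}h1 := h1 ltac:(lia); have := leq_mul h2 (leqnn q.2); lia.
have [|||i hr] := longest_run_attained _ _ N _ p cz; try lia.
apply: le_trans (cce_ge_run _ _ _ _ _ hr).
  by rewrite ler_frac ?e //; lia.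
by rewrite /longest_run; lia.
Qed.

(** * Finite checks, short prefixes and odd lengths *)

Definition ratios : seq (nat * nat) :=
  [:: (1, 1); (2, 1); (7, 3); (5, 2); (13, 5); (8, 3); (3, 1)].

Lemma ratios_rat q : q \in ratios -> (q.1%:R / q.2%:R \in
  [:: 1; 2; 7 / 3; 5 / 2; 13 / 5; 8 / 3; 3 : rat])%R.
Proof.
rewrite !inE; do ?[case/orP]; move=> /eqP->; by rewrite ?divr1 ?eqxx ?orbT.
Qed.

(** The doubled word [w ++ w] contains all circular factors of [w], and the sixth iterate has 64
    letters, enough for all [n <= 55]. *)
Lemma small_check : all (fun n => let w := take n (iter 6 mu [:: false]) in
  has (max_ratio n (w ++ w) n) ratios) (iota 1 55).
Proof. by vm_compute. Qed.

(* The 27 letters before the seam lie in two consecutive blocks of length 32, the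
   images of the letters a0 and a1 under the fifth power of mu. *)
Definition window (a0 a1 : bool) (b : nat) : word :=
  let block a := [seq a (+) x | x <- iter 5 mu [:: false]] in
  take 27 (drop b (block a0 ++ block a1)).

(** Offsets are even because [n - 27] is even for odd [n]. Dropping 1 and 2 leaves ratios of at
    least 7/3, above which the bounds 23 and 27 on runs hold. *)
Lemma window_check : all (fun m => all (fun a0 => all (fun a1 =>
    has (max_ratio 54 (window a0 a1 m.*2 ++ tm_prefix 27) 23) (drop 2 ratios))
  [:: false; true]) [:: false; true]) (iota 0 16).
(* By definition the letter of index [i] needs an iterate of length [2 ^ i]; the fifth iterate
   already covers 27 letters and keeps the evaluation feasible. *)
Proof. rewrite (tm_prefix_take 5 27 isT). by vm_compute. Qed.

Lemma cce_tm_prefix_small n : 0 < n <= 55 ->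
  exists2 q, q \in ratios & cce (tm_prefix n) = (q.1%:R / q.2%:R)%R.
Proof.
move=> n55; have n0 : 0 < n by lia.
have n_iota : n \in iota 1 55 by rewrite mem_iota; lia.
have : has (max_ratio n (tm_prefix n ++ tm_prefix n) n) ratios.
  rewrite (tm_prefix_take 6); first exact: (allP small_check _ n_iota).
  by apply: leq_trans (_ : 55 <= _); lia.
move=> /hasP[q qr hq]; exists q => //; have sn := size_tm_prefix n.
apply: (cce_max_ratio _ 0 _ _ _ _ _ _ _ _ _ _ _ hq); rewrite ?size_cat ?sn //; try lia.
- by move=> w0; rewrite w0 /= in sn; lia.
- by move: qr; rewrite !inE; do ?[case/orP]; move=> /eqP->.
- move=> j jn; rewrite add0n nth_cat sn /cyc sn; case: ltnP => nj.
    by rewrite modn_small.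
  by rewrite -(modn_small (_ : j - n < n)) -?[in RHS](modnDr (j - n)) ?subnK //; lia.
by move=> i l p ni ln hr _; exists i; have [] := hr; split=> //; lia.
Qed.

Lemma nth_window k b j : j < 27 -> j + b < 2 ^ 6 ->
  nth false (window (thue_morse k) (thue_morse k.+1) b) j =
  thue_morse (k * 2 ^ 5 + b + j).
Proof.
move=> j27 jb; rewrite nth_take // nth_drop nth_cat size_map size_iter_mu.
case: ltnP => lt.
  rewrite (nth_map false) ?size_iter_mu // thue_morse_iter //.
  by rewrite -addnA thue_morse_block.
have lt5 : b + j - 2 ^ 5 < 2 ^ 5 by lia.
rewrite (nth_map false) ?size_iter_mu // thue_morse_iter // -(thue_morse_block 5) //.
congr thue_morse; lia.
Qed.

Lemma cce_tm_prefix_odd n : odd n -> 55 < n ->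
  exists2 q, q \in ratios & cce (tm_prefix n) = (q.1%:R / q.2%:R)%R.
Proof.
move=> on n55; have n0 : 0 < n by lia.
(* The 27 letters before the seam start at offset [2b <= 30] in block [k], hence end within block
   [k + 1]. *)
pose k := (n - 27) %/ 2 ^ 5; pose b := ((n - 27) %% 2 ^ 5)./2.
have en : n - 27 = k * 2 ^ 5 + b.*2.
  have := divn_eq (n - 27) (2 ^ 5); have : ~~ odd ((n - 27) %% 2 ^ 5) by lia.
  by rewrite /k /b; lia.
have b16 : b < 16 by have := ltn_pmod (n - 27) (isT : 0 < 2 ^ 5); rewrite /b; lia.
have bool_in x : x \in [:: false; true] by case: x.
have bI : b \in iota 0 16 by rewrite mem_iota.
have := allP (allP (allP window_check _ bI) _ (bool_in (thue_morse k))) _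
  (bool_in (thue_morse k.+1)).
set z := _ ++ _ => /hasP[q qr hq]; exists q; first exact: mem_drop qr.
have sn := size_tm_prefix n.
have su : size (window (thue_morse k) (thue_morse k.+1) b.*2) = 27.
  by rewrite size_takel // size_drop size_cat !size_map size_iter_mu; lia.
have sz : size z = 54 by rewrite size_cat su size_tm_prefix.
have /andP[q0 q73] : (0 < q.2) && (7 * q.2 <= q.1 * 3).
  by move: qr; rewrite !inE; do ?[case/orP]; move=> /eqP->.
apply: (cce_max_ratio _ (n - 27) _ _ _ _ _ _ _ _ _ _ _ hq); rewrite ?sz ?sn //; try lia.
- by move=> w0; rewrite w0 /= in sn; lia.
- move=> j j54; rewrite nth_cat su; case: ltnP => j27.
    rewrite nth_window //; last lia.
    by rewrite cyc_tm_prefix_l ?en //; lia.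
  have -> : n - 27 + j = n + (j - 27) by lia.
  by rewrite cyc_tm_prefix_r ?nth_mkseq //; lia.
move=> i l p ni ln hr lt.
have lp : 7 * p < 3 * l.
  rewrite -(ltn_pmul2r q0); apply: leq_ltn_trans (_ : q.1 * p * 3 < _).
    by rewrite mulnAC [leqRHS]mulnAC leq_mul2r q73 orbT.
  by rewrite [ltnLHS]mulnC -[ltnRHS]mulnA ltn_mul2l.
have [p23 il ir] := odd_tm_prefix_run _ _ _ _ on ni ln hr lp.
exists (i - (n - 27)); split; try lia.
by rewrite subnKC //; lia.
Qed.

(** * Even lengths and the induction *)

Lemma cyc_tm_prefix_double m k : 0 < m ->
  cyc (tm_prefix m.*2) k.*2 = cyc (tm_prefix m) k.
Proof.
move=> m0; rewrite !cyc_tm_prefix ?double_gt0 // -!muln2 -muln_modl.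
by rewrite muln2 thue_morse_double.
Qed.

Lemma cyc_tm_prefix_doubleS m k : 0 < m ->
  cyc (tm_prefix m.*2) k.*2.+1 = ~~ cyc (tm_prefix m) k.
Proof.
move=> m0; rewrite !cyc_tm_prefix ?double_gt0 // -thue_morse_doubleS.
congr thue_morse; rewrite {1}(divn_eq k m) doubleD -addnS doubleMr modnMDl.
by rewrite modn_small // ltn_Sdouble ltn_mod.
Qed.

(** Doubling a run keeps its ratio. Conversely, a best run of ratio above 2 has even period, and
    halving it does not lower the ratio. *)
Lemma cce_tm_prefix_double m : 0 < m -> (2 < cce (tm_prefix m.*2))%R ->
  cce (tm_prefix m.*2) = cce (tm_prefix m).
Proof.
move=> m0 gt2; have c0 k := cyc_tm_prefix_double m k m0.
have c1 k := cyc_tm_prefix_doubleS m k m0.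
have nnil n : 0 < n -> tm_prefix n <> [::] by case: n.
apply/le_anti/andP; split; last first.
  have [i [l [p [_ lm hr ->]]]] := cce_eq_run _ (nnil _ m0).
  have := run_double _ _ _ _ _ c0 c1 hr; rewrite size_tm_prefix in lm.
  move/cce_ge_run; rewrite size_tm_prefix leq_double => /(_ lm).
  by apply: le_trans; have [p0 _ _] := hr; rewrite ler_frac; lia.
have m20 : 0 < m.*2 by lia.
have [i [l [p [_ lm hr e]]]] := cce_eq_run _ (nnil _ m20).
have [p0 pl _] := hr; rewrite size_tm_prefix in lm.
have lp : p.*2 < l.
  have := ler_frac l p 2 1 p0 isT; rewrite divr1 => le2.
  by move: gt2; rewrite e ltNge le2; lia.
have ep : ~~ odd p.
  apply/negP => op; suff: l <= p.*2 by lia.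
  by apply: run_le_odd_period hr op => k; rewrite c0 c1.
have [q pq] : exists q, p = q.*2 by exists p./2; lia.
rewrite {}e {gt2}; subst p.
have [|r0 rl rh] := run_half _ _ _ _ _ c0 c1 hr; first lia.
(* Widening to whole blocks may exceed the length [m] of the circle. Since [l <= 2m], the capped run
   still has at least [l / 2] letters. *)
pose l' := minn m (uphalf (i + l) - i./2).
have hr' : run (cyc (tm_prefix m)) i./2 l' q.
  by split=> // [|j ij jl]; [lia | apply: rh; lia].
have l'm : l' <= size (tm_prefix m) by rewrite size_tm_prefix; lia.
apply: le_trans (cce_ge_run _ _ _ _ l'm hr').
by rewrite ler_frac; [| lia..]; nia.
Qed.

Lemma cce_tm_prefix_ge2 n : 2 < n -> (2 <= cce (tm_prefix n))%R.
Proof.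
(* The letters of index 1 and 2 are both 1. *)
move=> n3; have hr : run (cyc (tm_prefix n)) 1 2 1.
  split=> // j j1 j3; have -> : j = 1 by lia.
  by rewrite !cyc_tm_prefix_l //; lia.
have := cce_ge_run _ _ _ _ _ hr; rewrite size_tm_prefix divr1; apply; lia.
Qed.

Lemma cce_tm_prefix n : 0 < n ->
  exists2 q, q \in ratios & cce (tm_prefix n) = (q.1%:R / q.2%:R)%R.
Proof.
elim/ltn_ind: n => n IH n0.
have [n55|n55] := leqP n 55; first by apply: cce_tm_prefix_small; lia.
have [on|en] := boolP (odd n); first exact: cce_tm_prefix_odd.
have ge2 : (2 <= cce (tm_prefix n))%R by apply: cce_tm_prefix_ge2; lia.
have [gt2|le2] := ltP 2%R (cce (tm_prefix n)).
  have nE : n = n./2.*2 by lia.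
  rewrite nE cce_tm_prefix_double -?nE //; last lia.
  by apply: IH; lia.
exists (2, 1) => //; rewrite divr1; apply/le_anti/andP; split=> //.
Qed.

Local Open Scope ring_scope.

Theorem theorem6 (n : nat) (hn : (0 < n)%N) :
  cce (tm_prefix n) \in
    [:: 1; 2; 7 / 3; 5 / 2; 13 / 5; 8 / 3; 3 : rat].
Proof. by have [q qr ->] := cce_tm_prefix _ hn; apply: ratios_rat. Qed.
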